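(* Consider the magnetic oriented nodal analysis (MONA) system without sources, $$ \begin{pmatrix} A_R G^\psi A_R^\top & A_C & A_V \\ -A_C^\top & 0 & 0 \\ -A_V^\top & 0 & 0 \end{pmatrix} \frac{d}{dt}\begin{pmatrix} \psi \\ q_C \\ q_V \end{pmatrix} = - \begin{pmatrix} A_L \nabla \epsilon_L(A_L^\top \psi) \\ \nabla \epsilon_C(q_C) \\ 0 \end{pmatrix}, \qquad G^\psi = G\big(A_R^\top \tfrac{d}{dt}\psi\big), $$ for the unknown functions $\psi(t), q_C(t), q_V(t)$. Assume that $G^\psi$ is symmetric and positive definite (i.e. $G(v)$ is symmetric and positive definite for every $v$), that $\epsilon_L$ and $\epsilon_C$ are strictly convex with symmetric positive definite Hessians $\nabla^2\epsilon_L$, $\nabla^2\epsilon_C$ at every point, and that all these functions depend smoothly on their arguments. Assume further that $$ N([A_R,A_C,A_V,A_L]^\top)=\{0\} \qquad\text{and}\qquad N(A_V)=\{0\}. $$ Then the system is a regular differential-algebraic equation (DAE) of index $\nu\le 1$. If, in addition, $$ N([A_R,A_C,A_V]^\top)=\{0\} \qquad\text{and}\qquad N([A_C,A_V])=\{0\}, $$ then the system is a regular DAE of index $\nu=0$, i.e. an (implicit) ordinary differential equation.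
   Context: Circuit setting. A directed connected graph with $N_n$ nodes and $N_b$ branches has incidence matrix $A\in\mathbb{R}^{N_n\times N_b}$ with $A_{ij}=1$ if branch $j$ leaves node $i$, $A_{ij}=-1$ if branch $j$ enters node $i$, and $A_{ij}=0$ otherwise. The same letter $A$ denotes the reduced incidence matrix obtained by deleting the row of one grounded node. The branches are grouped into capacitors, inductors, resistors, voltage sources and current sources, and $A=[A_C,A_L,A_R,A_V,A_I]$ is the corresponding splitting of the columns into partial incidence matrices. $N(M)$ denotes the null space (kernel) of the matrix $M$, and $[M_1,M_2,\dots]$ denotes horizontal concatenation. Unknowns and data. $\psi$ is the vector of magnetic node potentials (one entry per non-grounded node); $q_C$ and $q_V$ are the vectors of charges at capacitors and voltage sources. $G(\cdot)$ is a smooth matrix-valued function on the space of resistor voltages (the generalized conductance matrix), and $\epsilon_L$, $\epsilon_C$ are smooth real-valued functions (magnetic energy of the inductors and electric energy of the capacitors). Notion of index. The system is viewed as a quasilinear DAE whose leading matrix is the matrix multiplying the time derivative, with $G^\psi$ regarded as a symmetric positive definite, solution-dependent matrix coefficient. It is a regular DAE of index $\nu=0$ (implicit ordinary differential equation) if the leading matrix is nonsingular. It is a regular DAE of index $\nu=1$ if it is not of index $0$ and can be brought, by constant orthogonal changes of unknowns and of equations, to Hessenberg form $M^\psi \frac{d}{dt}y=f(y,z)$, $0=g(y,z)$, with $M^\psi$ nonsingular and the Jacobian $D_z g(y,z)$ nonsingular. Index $\nu\le 1$ means that one of these two cases occurs. *)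

(* Defs.v *)
From HB Require Import structures.
From mathcomp Require Import all_boot all_order all_algebra.
From mathcomp Require Import all_classical all_reals all_analysis.

Set Implicit Arguments.
Unset Strict Implicit.
Unset Printing Implicit Defensive.

Import Order.TTheory GRing.Theory Num.Theory.
Import numFieldNormedType.Exports.

Local Open Scope classical_set_scope.
Local Open Scope ring_scope.

Definition null_space (R : realType) m n (M : 'M[R]_(m, n)) : set 'cV[R]_n :=
  [set x | M *m x = 0].

Definition spd (R : realType) n (M : 'M[R]_n) : Prop :=
  M^T = M /\ forall x : 'cV[R]_n, x != 0 -> 0 < (x^T *m M *m x) 0 0.

(* For m != n no rectangular matrix satisfies both equations; allowing two
   dimensions avoids casts between n and a block dimension n1 + n2. *)
Definition orthogonal_mx (R : realType) n m (U : 'M[R]_(n, m)) : Prop :=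
  U^T *m U = 1%:M /\ U *m U^T = 1%:M.

Section Calculus.
Variable R : realType.

(* On a finite-dimensional domain, f is C^(k+1) iff it is differentiable and
   all its directional derivatives are C^k. *)
Fixpoint class_C (k : nat) n (W : normedModType R) (f : 'cV[R]_n -> W) : Prop :=
  if k is k'.+1 then
    (forall x, differentiable f x) /\ (forall v, class_C k' (fun x => 'D_v f x))
  else continuous f.

Definition smooth n (W : normedModType R) (f : 'cV[R]_n -> W) : Prop :=
  forall k, class_C k f.

Definition grad n (f : 'cV[R]_n -> R) (x : 'cV[R]_n) : 'cV[R]_n :=
  \col_i 'D_(delta_mx i 0) f x.

(* The library's jacobian is for row vectors; this is the column-vector
   convention, with the partial derivatives of f as columns. *)
Definition jac n m (f : 'cV[R]_n -> 'cV[R]_m) (x : 'cV[R]_n) : 'M[R]_(m, n) :=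
  \matrix_(i, j) ('D_(delta_mx j 0) f x) i 0.

Definition hessian n (f : 'cV[R]_n -> R) (x : 'cV[R]_n) : 'M[R]_n :=
  jac (grad f) x.

Definition strictly_convex n (f : 'cV[R]_n -> R) : Prop :=
  forall (x y : 'cV[R]_n) (t : R), x != y -> 0 < t < 1 ->
    f (t *: x + (1 - t) *: y) < t * f x + (1 - t) * f y.

End Calculus.

(* The quasilinear system lead(x, x') x' = rhs(x). The leading matrix is a
   solution-dependent coefficient, which may depend on x' as well as on x. *)
Record qldae (R : realType) (n : nat) := Qldae {
  lead : 'cV[R]_n -> 'cV[R]_n -> 'M[R]_n ;
  rhs : 'cV[R]_n -> 'cV[R]_n }.

Section Index.
Variable R : realType.

(* Substitute x = V w and multiply the equations by U^T. *)
Definition transform n m (U V : 'M[R]_(n, m)) (S : qldae R n) : qldae R m :=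
  Qldae (fun w w' => U^T *m lead S (V *m w) (V *m w') *m V)
        (fun w => U^T *m rhs S (V *m w)).

(* With unknowns w = (y, z): M y' = f(y, z), 0 = g(y, z). *)
Definition hessenberg1 n1 n2 (S : qldae R (n1 + n2)) : Prop :=
  exists (M : 'cV[R]_(n1 + n2) -> 'cV[R]_(n1 + n2) -> 'M[R]_n1)
         (f : 'cV[R]_n1 -> 'cV[R]_n2 -> 'cV[R]_n1)
         (g : 'cV[R]_n1 -> 'cV[R]_n2 -> 'cV[R]_n2),
  [/\ forall w w', lead S w w' = block_mx (M w w') 0 0 0,
      forall y z, rhs S (col_mx y z) = col_mx (f y z) (g y z),
      forall w w', M w w' \in unitmx &
      forall y z, differentiable (g y) z /\ jac (g y) z \in unitmx].

Definition index0 n (S : qldae R n) : Prop :=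
  forall x x', lead S x x' \in unitmx.

Definition index1 n (S : qldae R n) : Prop :=
  ~ index0 S /\
  exists (n1 n2 : nat) (U V : 'M[R]_(n, n1 + n2)),
    [/\ orthogonal_mx U, orthogonal_mx V & hessenberg1 (transform U V S)].

Definition index_le1 n (S : qldae R n) : Prop := index0 S \/ index1 S.

End Index.

(* A directed connected multigraph on Nn nodes, one of them grounded; branches
   are numbered with the capacitors first, then the inductors, resistors,
   voltage sources and current sources. Self-loops are excluded because they
   have no column in the incidence matrix. *)
Record circuit (Nn nC nL nR nV nI : nat) := Circuit {
  src : 'I_(nC + (nL + (nR + (nV + nI)))) -> 'I_Nn ;
  dst : 'I_(nC + (nL + (nR + (nV + nI)))) -> 'I_Nn ;
  ground : 'I_Nn ;
  circuit_loopless : forall j, src j != dst j ;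
  circuit_connected : forall u v : 'I_Nn,
    connect (fun a b => [exists j, ((src j == a) && (dst j == b))
                                || ((src j == b) && (dst j == a))]) u v }.

Section Mona.
Variables (R : realType) (Nn nC nL nR nV nI : nat).
Variable net : circuit Nn nC nL nR nV nI.

Definition incidence : 'M[R]_(Nn, nC + (nL + (nR + (nV + nI)))) :=
  \matrix_(i, j) (if src net j == i then 1
                  else if dst net j == i then -1 else 0).

Definition reduced_incidence :
    'M[R]_(Nn.-1, nC + (nL + (nR + (nV + nI)))) :=
  row' (ground net) incidence.

Definition A_C : 'M[R]_(Nn.-1, nC) := lsubmx reduced_incidence.
Definition A_L : 'M[R]_(Nn.-1, nL) := lsubmx (rsubmx reduced_incidence).
Definition A_R : 'M[R]_(Nn.-1, nR) :=
  lsubmx (rsubmx (rsubmx reduced_incidence)).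
Definition A_V : 'M[R]_(Nn.-1, nV) :=
  lsubmx (rsubmx (rsubmx (rsubmx reduced_incidence))).

Variables (G : 'cV[R]_nR -> 'M[R]_nR).
Variables (epsL : 'cV[R]_nL -> R) (epsC : 'cV[R]_nC -> R).

(* The unknown is x = (psi, (q_C, q_V)). *)
Definition mona : qldae R (Nn.-1 + (nC + nV)) :=
  Qldae
    (fun _ x' =>
       let psi' := usubmx x' in
       block_mx (A_R *m G (A_R^T *m psi') *m A_R^T) (row_mx A_C A_V)
                (col_mx (- A_C^T) (- A_V^T))        0)
    (fun x =>
       let psi := usubmx x in
       let qC := usubmx (dsubmx x) in
       - col_mx (A_L *m grad epsL (A_L^T *m psi))
                (col_mx (grad epsC qC) 0)).

End Mona.

(* Main.v *)
(* Write B = [A_C, A_V] and H = A_R G A_R^T. Testing the equation L (u, w) = 0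
   for the leading matrix L = [[H, B], [-B^T, 0]] with (u, w) gives u^T H u = 0,
   so A_R^T u = 0 by positive definiteness of G; hence ker L, and likewise
   ker L^T, is the constant space K = N([A_R, B]^T) x N(B). In an orthonormal
   basis adapted to K^perp (+) K, used for unknowns and equations alike, L
   becomes diag(M, 0) with M nonsingular. The Jacobian of the algebraic part is
   the compression to K of the symmetric, negative semidefinite matrix
   -diag(A_L (Hess eps_L) A_L^T, Hess eps_C, 0). It is definite on K: if the form
   vanishes at (u, q_C, q_V) in K then A_L^T u = 0 and q_C = 0, so u = 0 by the
   first null space assumption and q_V = 0 by N(A_V) = 0. *)
Require Import Defs.
From HB Require Import structures.
From mathcomp Require Import all_boot all_order all_algebra.
From mathcomp Require Import all_classical all_reals all_analysis.

Set Implicit Arguments.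
Unset Strict Implicit.
Unset Printing Implicit Defensive.

Import Order.TTheory GRing.Theory Num.Theory.
Import numFieldNormedType.Exports.

Local Open Scope classical_set_scope.
Local Open Scope ring_scope.

(** * Linear algebra: kernels and orthonormal bases *)

Lemma null_space0P (R : realType) m n (M : 'M[R]_(m, n)) :
  null_space M = [set 0] -> forall x : 'cV[R]_n, M *m x = 0 -> x = 0.
Proof. by move=> M0 x Mx; have: null_space M x by []; rewrite M0. Qed.

Lemma injective_unitmx (F : fieldType) n (A : 'M[F]_n) :
  (forall v : 'cV[F]_n, A *m v = 0 -> v = 0) -> A \in unitmx.
Proof.
move=> Ainj; rewrite -unitmx_tr -row_free_unit; apply: inj_row_free => v vA.
apply: trmx_inj; rewrite trmx0; apply: Ainj.
by rewrite -[A]trmxK -trmx_mul vA trmx0.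
Qed.

Lemma trmx_mul_self_gt0 (R : realDomainType) n (v : 'cV[R]_n) :
  v != 0 -> 0 < (v^T *m v) 0 0.
Proof.
move=> v0; rewrite mxE lt_neqAle eq_sym; apply/andP; split; last first.
  by apply: sumr_ge0 => i _; rewrite mxE -expr2 sqr_ge0.
apply: contra v0; rewrite psumr_eq0; last first.
  by move=> i _; rewrite mxE -expr2 sqr_ge0.
move=> /allP v0; apply/eqP/colP => i; rewrite [RHS]mxE.
by have /implyP/(_ isT) := v0 i (mem_index_enum i); rewrite mxE -expr2 sqrf_eq0 => /eqP.
Qed.

(** Induction on the number of rows: orthonormalise all rows but the first, subtract from the first
    its projection onto their span, and normalise the remainder. *)
Lemma gram_schmidt (R : rcfType) k n (A : 'M[R]_(k, n)) :
  row_free A -> exists P : 'M[R]_(k, n), P *m P^T = 1%:M /\ (P <= A)%MS.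
Proof.
elim: k A => [|k IH] A Afree.
  by exists 0; split; [rewrite flatmx0; apply/esym; rewrite flatmx0 | exact: sub0mx].
pose a : 'rV[R]_n := @usubmx _ 1 k n A; pose A' : 'M[R]_(k, n) := @dsubmx _ 1 k n A.
have {Afree} Ainj (v : 'rV[R]_(1 + k)) : v *m col_mx a A' = 0 -> v = 0.
  by rewrite vsubmxK => vA; apply/eqP; rewrite -(mulmx_free_eq0 v Afree) vA.
have /andP[aA A'A] : (a <= A)%MS && (A' <= A)%MS by rewrite -col_mx_sub vsubmxK.
have A'free : row_free A'.
  apply: inj_row_free => v vA'.
  have /(congr1 (@rsubmx _ 1 1 k)) : row_mx (0 : 'rV[R]_1) v = 0.
    by apply: Ainj; rewrite mul_row_col mul0mx add0r.
  by rewrite row_mxKr => ->; apply/rowP => i; rewrite !mxE.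
have [P [PP PA]] := IH _ A'free.
pose b := a - a *m P^T *m P.
have bP : b *m P^T = 0.
  by rewrite mulmxBl -!mulmxA PP mulmx1 subrr.
(* If [b] vanished, [a] would lie in the span of [A'], and the coefficients (1, -D) would give a
   nontrivial relation between independent rows. *)
have b0 : b != 0.
  apply/eqP => b0; have /submxP[D DA] : (a *m P^T *m P <= A')%MS by exact: mulmx_sub.
  have /(congr1 (@lsubmx _ 1 1 k)) : row_mx (1%:M : 'rV[R]_1) (- D) = 0.
    by apply: Ainj; rewrite mul_row_col mul1mx mulNmx -DA.
  rewrite row_mxKl => /matrixP/(_ 0 0); rewrite !mxE => /eqP.
  by rewrite eqxx oner_eq0.
pose s := (b *m b^T) 0 0.
have s0 : 0 < s.
  by rewrite /s -{1}[b]trmxK trmx_mul_self_gt0 // -trmx0 (inj_eq (@trmx_inj _ _ _)).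
pose r := (Num.sqrt s)^-1.
have bb : b *m b^T = s%:M by rewrite [LHS]mx11_scalar.
pose Q := col_mx (r *: b) P.
have QQ : Q *m Q^T = 1%:M.
  rewrite tr_col_mx mul_col_row linearZ /= -!scalemxAl -!scalemxAr bP bb.
  have -> : r *: (r *: s%:M) = 1%:M :> 'M[R]_1.
    by rewrite scalerA scale_scalar_mx -invfM -expr2 sqr_sqrtr ?ltW // mulVf ?gt_eqF.
  have Pb : P *m b^T = 0 by rewrite -[P]trmxK -trmx_mul bP trmx0.
  by rewrite PP Pb !scaler0 -scalar_mx_block.
have QA : (Q <= A)%MS.
  rewrite col_mx_sub (submx_trans PA) // andbT scalemx_sub // addmx_sub //.
  by rewrite eqmx_opp (submx_trans _ A'A) // mulmx_sub.
by exists Q.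
Qed.

Lemma mulmx1C_eq (R : comNzRingType) m n (A : 'M[R]_(m, n)) (B : 'M[R]_(n, m)) :
  m = n -> A *m B = 1%:M -> B *m A = 1%:M.
Proof. by move=> mn; move: A B; case: n / mn => A B; exact: mulmx1C. Qed.

(** The columns of [V] are an orthonormal basis of the row space of [K], which is the orthogonal
    complement of ker K, followed by one of ker K. As [kermx] is a left kernel, ker K is obtained
    from [kermx K^T]. *)
Lemma orthogonal_split (R : realType) p n (K : 'M[R]_(p, n)) :
  exists n1 n2 (V : 'M[R]_(n, n1 + n2)),
    [/\ orthogonal_mx V, K *m rsubmx V = 0 &
        forall x : 'cV[R]_n, K *m x = 0 -> (lsubmx V)^T *m x = 0].
Proof.
have [P1 [P11 P1K]] := gram_schmidt (row_base_free K).
have [P2 [P22 P2K]] := gram_schmidt (row_base_free (kermx K^T)).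
rewrite !eq_row_base in P1K P2K.
have KP2 : K *m P2^T = 0.
  by apply: trmx_inj; rewrite trmx0 trmx_mul trmxK; apply/sub_kermxP.
have KP1 x : K *m x = 0 -> P1 *m x = 0 :> 'cV[R]__.
  by have /submxP[D ->] := P1K => Kx; rewrite -mulmxA Kx mulmx0.
have P12 : P1 *m P2^T = 0.
  by have /submxP[D ->] := P1K; rewrite -mulmxA KP2 mulmx0.
have P21 : P2 *m P1^T = 0 by rewrite -[P2]trmxK -trmx_mul P12 trmx0.
exists (\rank K), (\rank (kermx K^T)), (row_mx P1^T P2^T).
have VV : (row_mx P1^T P2^T)^T *m row_mx P1^T P2^T = 1%:M.
  by rewrite tr_row_mx mul_col_row !trmxK P11 P22 P12 P21 -scalar_mx_block.
split; rewrite ?row_mxKr ?row_mxKl ?trmxK //; split => //.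
(* [V] is square by rank-nullity only, not by conversion. *)
apply: mulmx1C_eq VV.
by rewrite mxrank_ker mxrank_tr subnKC // rank_leq_col.
Qed.

(** * Differentials, Jacobians and the chain rule *)

Section Jacobian.
Variable R : realType.

Lemma differentiable_mulmx m n (A : 'M[R]_(m, n)) (x : 'cV[R]_n) :
  differentiable (fun x => A *m x) x.
Proof.
have -> : (fun x : 'cV[R]_n => A *m x) =
    \sum_(j < n) (fun x : 'cV[R]_n => x j 0 *: col j A).
  apply/funext => y; rewrite fct_sumE; apply/colP => i.
  by rewrite !mxE summxE; apply: eq_bigr => j _; rewrite !mxE mulrC.
by apply: differentiable_sum => j; apply/differentiableZl/differentiable_coord.
Qed.

Lemma is_diff_mulmx m n (A : 'M[R]_(m, n)) (x : 'cV[R]_n) :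
  is_diff x (fun x => A *m x) (fun x => A *m x).
Proof.
apply: DiffDef; first exact: differentiable_mulmx.
apply: (@diff_lin _ _ _ (mulmx A)) => y.
exact/differentiable_continuous/differentiable_mulmx.
Qed.

Lemma jacE n m (f : 'cV[R]_n -> 'cV[R]_m) (x v : 'cV[R]_n) :
  differentiable f x -> jac f x *m v = 'd f x v.
Proof.
move=> df; rewrite [in RHS](matrix_sum_delta v) linear_sum; apply/colP => i.
rewrite !mxE summxE; apply: eq_bigr => j _.
by rewrite big_ord1 linearZ !mxE deriveE // mulrC.
Qed.

Lemma is_diff_jac n m (f : 'cV[R]_n -> 'cV[R]_m) (x : 'cV[R]_n) :
  differentiable f x -> is_diff x f (fun v => jac f x *m v).
Proof. by move=> df; apply: DiffDef => //; apply/funext => v; rewrite jacE. Qed.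

Lemma is_diff_affine_comp n m p q (A : 'M[R]_(q, p)) (f : 'cV[R]_m -> 'cV[R]_p)
    (B : 'M[R]_(m, n)) (c : 'cV[R]_m) (x : 'cV[R]_n) :
  differentiable f (c + B *m x) ->
  is_diff x (fun x => A *m f (c + B *m x))
            (fun v => A *m (jac f (c + B *m x) *m (B *m v))).
Proof.
move=> df.
have dB : is_diff x (fun x => c + B *m x) (fun x => B *m x).
  rewrite -[X in is_diff _ _ X]add0r.
  exact: is_diffD (is_diff_cst c x) (is_diff_mulmx B x).
have dfB := is_diff_comp dB (is_diff_jac df).
exact: is_diff_comp dfB (is_diff_mulmx A _).
Qed.

Lemma differentiable_grad n (f : 'cV[R]_n -> R) (x : 'cV[R]_n) :
  smooth f -> differentiable (grad f) x.
Proof.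
move=> f_smooth.
have -> : grad f =
    \sum_(i < n) (fun x => 'D_(delta_mx i 0) f x *: (delta_mx i 0 : 'cV[R]_n)).
  apply/funext => y; rewrite fct_sumE; apply/colP => i.
  rewrite mxE summxE (bigD1 i) //= big1 => [|j ji]; rewrite !mxE !eqxx.
    by rewrite mulr1 addr0.
  by rewrite eq_sym (negbTE ji) mulr0.
apply: differentiable_sum => i; apply: differentiableZl.
(* C^2 regularity makes each partial derivative differentiable. *)
by have [_ /(_ (delta_mx i 0))[]] := f_smooth 2.
Qed.

End Jacobian.

(** * Index criterion for a leading matrix with constant kernel *)

Lemma index_le1_const_kernel (R : realType) p n (S : qldae R n) (K : 'M[R]_(p, n)) :
  (forall x x' (v : 'cV_n), lead S x x' *m v = 0 <-> K *m v = 0) ->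
  (forall x x' (v : 'cV_n), (lead S x x')^T *m v = 0 <-> K *m v = 0) ->
  (forall x, differentiable (rhs S) x) ->
  (forall x (v : 'cV_n), K *m v = 0 -> v != 0 -> (v^T *m jac (rhs S) x *m v) 0 0 < 0) ->
  index_le1 S.
Proof.
move=> Lker LTker drhs jac_neg.
have [S0|S1] := pselect (index0 S); [by left | right; split => //].
have [n1 [n2 [V [[VV VVT] KV2 KV1]]]] := orthogonal_split K.
exists n1, n2, V, V; split => //.
rewrite -(hsubmxK V) in VV VVT *.
set V1 := lsubmx V in VV VVT KV1 *; set V2 := rsubmx V in VV VVT KV2 *.
move: VV; rewrite tr_row_mx mul_col_row scalar_mx_block.
move=> /eq_block_mx[V11 V12 V21 V22].
have V_eq0 (x : 'cV_n) : V1^T *m x = 0 -> V2^T *m x = 0 -> x = 0.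
  move=> x1 x2; rewrite -[x]mul1mx -VVT tr_row_mx -mulmxA mul_col_mx x1 x2.
  by rewrite col_mx0 mulmx0.
have LV2 x x' : lead S x x' *m V2 = 0.
  apply/matrixP => i j.
  have /colP/(_ i) : lead S x x' *m col j V2 = 0.
    by apply/Lker; rewrite colE mulmxA KV2 mul0mx.
  by rewrite colE mulmxA -colE !mxE.
have V2L x x' : V2^T *m lead S x x' = 0.
  apply: trmx_inj; rewrite trmx_mul trmxK trmx0; apply/matrixP => i j.
  have /colP/(_ i) : (lead S x x')^T *m col j V2 = 0.
    by apply/LTker; rewrite colE mulmxA KV2 mul0mx.
  by rewrite colE mulmxA -colE !mxE.
set W := row_mx V1 V2.
(* The witnesses are the only block of V^T L V that survives and the two block rows of V^T rhs(V
   w). *)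
exists (fun w w' => V1^T *m lead S (W *m w) (W *m w') *m V1),
  (fun y z => V1^T *m rhs S (V1 *m y + V2 *m z)),
  (fun y z => V2^T *m rhs S (V1 *m y + V2 *m z)); split.
- move=> w w'; rewrite /= tr_row_mx mul_col_mx mul_col_row -/W.
  by rewrite !V2L -(mulmxA _ _ V2) LV2 !mul0mx mulmx0.
- by move=> y z; rewrite /= mul_row_col tr_row_mx mul_col_mx.
- move=> w w'; apply: injective_unitmx => v; set L := lead S _ _ => MV.
  (* Both V1^T and V2^T annihilate L V1 v, so V1 v lies in ker L = ker K. This kernel is orthogonal
     to the columns of [V1], whence v = V1^T V1 v = 0. *)
  have : L *m (V1 *m v) = 0.
    by apply: V_eq0; rewrite !mulmxA // V2L !mul0mx.
  by move=> /Lker/KV1; rewrite mulmxA V11 mul1mx.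
- move=> y z; have dg := is_diff_affine_comp V2^T (drhs (V1 *m y + V2 *m z)).
  split; first exact: ex_diff.
  apply: injective_unitmx => v; rewrite jacE; last exact: ex_diff.
  rewrite diff_val => Jv.
  (* If V2 v were nonzero, it would be a kernel vector on which the form is negative, while [Jv]
     makes the form vanish there. *)
  have [/(congr1 (mulmx V2^T))|/jac_neg Vneg] := eqVneq (V2 *m v) 0.
    by rewrite mulmxA V22 mul1mx mulmx0.
  have := Vneg (V1 *m y + V2 *m z); rewrite mulmxA KV2 mul0mx => /(_ erefl).
  by rewrite trmx_mul -!mulmxA Jv mulmx0 mxE ltxx.
Qed.

(** * Positive definite forms and saddle-point matrices *)

Lemma spd_form_ge0 (R : realType) n (M : 'M[R]_n) (x : 'cV[R]_n) :
  spd M -> 0 <= (x^T *m M *m x) 0 0.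
Proof.
case=> _ Mpos; have [->|/Mpos/ltW//] := eqVneq x 0.
by rewrite mulmx0 mxE.
Qed.

Lemma spd_form_eq0 (R : realType) n (M : 'M[R]_n) (x : 'cV[R]_n) :
  spd M -> (x^T *m M *m x) 0 0 = 0 -> x = 0.
Proof.
case=> _ Mpos xMx; apply: contra_eq xMx => /Mpos xMx.
by rewrite gt_eqF.
Qed.

(** The kernel conditions do not involve [M], so the kernel does not vary with the solution. The
    sign of [B] is immaterial to them, which lets the lemma handle the transposed matrix too. *)
Lemma saddle_ker (R : realType) n r b (A : 'M[R]_(n, r)) (M : 'M[R]_r)
    (B : 'M[R]_(n, b)) (u : 'cV[R]_n) (w : 'cV[R]_b) : spd M ->
  block_mx (A *m M *m A^T) B (- B^T) 0 *m col_mx u w = 0 <->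
  [/\ A^T *m u = 0, B^T *m u = 0 & B *m w = 0].
Proof.
move=> Mspd; rewrite mul_block_col mul0mx addr0; split; last first.
  by case=> Au Bu Bw; rewrite -!mulmxA Au Bw !mulmx0 mulNmx Bu addr0 oppr0 col_mx0.
move=> /eqP; rewrite col_mx_eq0 mulNmx oppr_eq0 => /andP[/eqP Hu /eqP Bu].
have uB : u^T *m B = 0 by apply: trmx_inj; rewrite trmx_mul trmxK Bu trmx0.
have Au : A^T *m u = 0.
  apply: (spd_form_eq0 Mspd); have /(congr1 (mulmx u^T)) := Hu.
  rewrite mulmxDr mulmx0 [u^T *m (B *m w)]mulmxA uB mul0mx addr0 => uHu.
  by rewrite trmx_mul trmxK -!mulmxA in uHu *; rewrite uHu mxE.
by move: Hu; rewrite -!mulmxA Au !mulmx0 add0r.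
Qed.

(** * The MONA system *)

Theorem lemma2 (R : realType) (Nn nC nL nR nV nI : nat)
    (net : circuit Nn nC nL nR nV nI)
    (G : 'cV[R]_nR -> 'M[R]_nR)
    (epsL : 'cV[R]_nL -> R) (epsC : 'cV[R]_nC -> R)
    (G_smooth : smooth G) (epsL_smooth : smooth epsL) (epsC_smooth : smooth epsC)
    (G_spd : forall v, spd (G v))
    (epsL_convex : strictly_convex epsL)
    (epsC_convex : strictly_convex epsC)
    (epsL_hess : forall x, spd (hessian epsL x))
    (epsC_hess : forall x, spd (hessian epsC x))
    (N_RCVL : null_space (row_mx (A_R R net) (row_mx (A_C R net)
                (row_mx (A_V R net) (A_L R net))))^T = [set 0])
    (N_V : null_space (A_V R net) = [set 0]) :
  index_le1 (mona net G epsL epsC) /\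
  (null_space (row_mx (A_R R net) (row_mx (A_C R net) (A_V R net)))^T = [set 0] ->
   null_space (row_mx (A_C R net) (A_V R net)) = [set 0] ->
   index0 (mona net G epsL epsC)).
Proof.
pose A := A_R R net; pose B := row_mx (A_C R net) (A_V R net).
(* [QL] and [QC] send (psi, q_C, q_V) to A_L^T psi and q_C, the arguments of the two energy
   gradients; ker K is N([A, B]^T) x N(B). *)
pose QL := row_mx (A_L R net)^T (0 : 'M[R]_(nL, nC + nV)).
pose QC := row_mx (0 : 'M[R]_(nC, Nn.-1)) (row_mx 1%:M (0 : 'M[R]_(nC, nV))).
pose K := block_mx (row_mx A B)^T 0 0 B.
have leadE x x' : lead (mona net G epsL epsC) x x' =
    block_mx (A *m G (A^T *m usubmx x') *m A^T) B (- B^T) 0.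
  by rewrite /= tr_row_mx opp_col_mx.
have K_ker u w : K *m col_mx u w = 0 <->
    [/\ A^T *m u = 0, B^T *m u = 0 & B *m w = 0 :> 'cV_Nn.-1].
  rewrite mul_block_col !mul0mx addr0 add0r tr_row_mx mul_col_mx.
  split=> [/eqP|[-> -> ->]]; last by rewrite !col_mx0.
  by rewrite !col_mx_eq0 => /andP[/andP[/eqP-> /eqP->] /eqP->].
have lead_ker x x' (v : 'cV_(Nn.-1 + (nC + nV))) :
    lead (mona net G epsL epsC) x x' *m v = 0 <-> K *m v = 0.
  by rewrite leadE -[v]vsubmxK K_ker; apply: saddle_ker.
have leadT_ker x x' (v : 'cV_(Nn.-1 + (nC + nV))) :
    (lead (mona net G epsL epsC) x x')^T *m v = 0 <-> K *m v = 0.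
  have [GT _] := G_spd (A^T *m usubmx x').
  rewrite leadE -[v]vsubmxK K_ker tr_block_mx trmx0 !trmx_mul trmxK GT mulmxA.
  rewrite linearN /= trmxK.
  (* By symmetry of [G], the transpose is again a saddle-point matrix, with -B in place of B. *)
  have {1}-> : B^T = - (- B)^T by rewrite linearN opprK.
  rewrite saddle_ker // linearN /= !mulNmx.
  by split=> -[-> /eqP Bu /eqP Bw]; split=> //; apply/eqP;
    rewrite ?oppr_eq0 // -oppr_eq0.
split; last first.
  (* The two additional assumptions say that both factors of ker K are trivial. *)
  move=> RCV CV x x'; apply: injective_unitmx => v /lead_ker.
  rewrite -[v]vsubmxK mul_block_col !mul0mx addr0 add0r => /eqP.
  rewrite col_mx_eq0 => /andP[/eqP/(null_space0P RCV)-> /eqP/(null_space0P CV)->].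
  exact: col_mx0.
(* The right-hand side is minus the gradient of the total energy epsL(QL x) + epsC(QC x); the
   summand 0 fits the affine chain rule. *)
have rhsE : rhs (mona net G epsL epsC) =
    - ((fun x => QL^T *m grad epsL (0 + QL *m x)) +
       (fun x => QC^T *m grad epsC (0 + QC *m x))).
  apply/funext => x; rewrite /= -[x in RHS]vsubmxK -[dsubmx x in RHS]vsubmxK.
  rewrite !fctE /QL /QC !tr_row_mx !mul_row_col !mul_col_mx !trmx0 trmx1 trmxK.
  by rewrite !mul0mx !mul1mx !addr0 !add0r add_col_mx addr0 add0r.
have drhs x : is_diff x (rhs (mona net G epsL epsC))
    (- ((fun v => QL^T *m (hessian epsL (0 + QL *m x) *m (QL *m v))) +
        (fun v => QC^T *m (hessian epsC (0 + QC *m x) *m (QC *m v))))).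
  rewrite rhsE; apply/is_diffN/is_diffD;
    exact/is_diff_affine_comp/differentiable_grad.
apply: (@index_le1_const_kernel _ _ _ _ K) => // x v Kv v0.
rewrite -mulmxA jacE // diff_val.
set HL := hessian epsL _; set HC := hessian epsC _.
have -> : v^T *m - (QL^T *m (HL *m (QL *m v)) + QC^T *m (HC *m (QC *m v))) =
    - ((QL *m v)^T *m HL *m (QL *m v) + (QC *m v)^T *m HC *m (QC *m v)).
  by rewrite mulmxN mulmxDr !trmx_mul !mulmxA.
have HL_spd : spd HL := epsL_hess _; have HC_spd : spd HC := epsC_hess _.
have HL_ge0 := spd_form_ge0 (QL *m v) HL_spd.
have HC_ge0 := spd_form_ge0 (QC *m v) HC_spd.
rewrite mxE oppr_lt0 mxE lt_neqAle addr_ge0 // andbT eq_sym.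
(* Two nonnegative Hessian forms with sum zero both vanish, so QL v = 0 and QC v = 0. *)
apply: contra v0; rewrite paddr_eq0 // => /andP[/eqP Lv /eqP Cv].
move: Kv (spd_form_eq0 HL_spd Lv) (spd_form_eq0 HC_spd Cv).
rewrite -[v]vsubmxK -[dsubmx v]vsubmxK => /K_ker[].
rewrite tr_row_mx mul_col_mx mul_row_col => Au /eqP.
rewrite col_mx_eq0 => /andP[/eqP Cu /eqP Vu].
rewrite !mul_row_col !mul0mx mul1mx !addr0 add0r => + Lu c0.
(* With q_C = 0, the condition B w = 0 reduces to A_V q_V = 0. *)
rewrite c0 mulmx0 add0r => /(null_space0P N_V)->.
have -> : usubmx v = 0.
  apply: (null_space0P N_RCVL).
  by rewrite !tr_row_mx !mul_col_mx Au Cu Vu Lu !col_mx0.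
by rewrite !col_mx0.
Qed.
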